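(* Let $Y\in\mathcal{G}$ and $x\ge 0$, and let $\left|x\left(\mathbb{E}e^{tY}-1\right)\right|\le 1$. Then $$\frac{1}{1-x\left(\mathbb{E}e^{tY}-1\right)}=\sum_{n=0}^{\infty} W_n^Y(x)\,\frac{t^n}{n!}.$$
   Context: $\mathbb{N}_0=\{0,1,2,\dots\}$. $\mathcal{G}$ is the set of real random variables $Y$ such that $\mathbb{E}|Y|^n<\infty$ for all $n\in\mathbb{N}_0$ and, for some $r>0$, $\lim_{n\to\infty}|t|^n\mathbb{E}|Y|^n/n!=0$ for all $|t|<r$ (so $Y$ has a moment generating function). Let $Y_1,Y_2,\dots$ be i.i.d. copies of $Y$, $S_0=0$ and $S_i=Y_1+\cdots+Y_i$ for $i\ge1$ (convention $0^0=1$). For $x\ge0$ the probabilistic Fubini polynomials associated with $Y$ are $$W_n^Y(x)=\sum_{i=0}^{\infty}\mathbb{E}[S_i^n]\,P\{G_{\eta(x)}=i+1\}=\sum_{i=0}^\infty \mathbb{E}[S_i^n]\,\frac{1}{1+x}\left(\frac{x}{1+x}\right)^i,\qquad n\in\mathbb{N}_0,$$ where $\eta(x)=1/(1+x)$ and $G_p$ is a geometric random variable with $P\{G_p=i\}=p(1-p)^{i-1}$, $i\ge1$.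
   Formalization: Proved for real t with two added conditions: x(E e^{tY}−1) ≠ 1 (else the left side is 1/0) and x(E e^{−tY}−1) < 1 (else the series can diverge, e.g. Y=1, x=1/2, t=−100). *)

(* Defs.v *)
From HB Require Import structures.
From mathcomp Require Import all_boot all_order all_algebra.
From mathcomp Require Import finmap.
From mathcomp Require Import all_classical all_reals all_analysis.

Set Implicit Arguments.
Unset Strict Implicit.
Unset Printing Implicit Defensive.

Import Order.TTheory GRing.Theory Num.Theory.
Import numFieldNormedType.Exports.

Local Open Scope classical_set_scope.
Local Open Scope ring_scope.

(* The class G of random variables having a moment generating function near 0:
   all absolute moments are finite and, for some r > 0,
   |t|^n E|Y|^n / n! -> 0 whenever |t| < r. *)
Definition in_class_G (d : measure_display) (T : measurableType d)
    (R : realType) (P : probability T R) (Y : {RV P >-> R}) : Prop :=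
  (forall n : nat, ('E_P[(fun w => `|Y w| ^+ n)%R] < +oo)%E) /\
  exists2 r : R, 0 < r & forall t : R, `|t| < r ->
    (fun n : nat => `|t| ^+ n * fine 'E_P[(fun w => `|Y w| ^+ n)%R] / n`!%:R)
      @ \oo --> (0 : R).

Definition mutually_independent (d : measure_display) (T : measurableType d)
    (R : realType) (P : probability T R) (Ys : nat -> {RV P >-> R}) : Prop :=
  forall (J : {fset nat}) (B : nat -> set R), (forall i, measurable (B i)) ->
    P (\bigcap_(i in [set` J]) (Ys i @^-1` B i)) =
      (\prod_(i <- J) P (Ys i @^-1` B i))%E.

(* The copies may live on another probability space than Y itself. *)
Definition iid_copies (d0 d : measure_display) (T0 : measurableType d0)
    (T : measurableType d) (R : realType) (P0 : probability T0 R)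
    (P : probability T R) (Y : {RV P0 >-> R}) (Ys : nat -> {RV P >-> R}) : Prop :=
  mutually_independent Ys /\
  forall (i : nat) (B : set R), measurable B ->
    distribution P (Ys i) B = distribution P0 Y B.

(* Indices are shifted: Ys 0 is Y_1, so that this is S_i = Y_1 + ... + Y_i. *)
Definition partial_sum (T : Type) (R : realType) (Ys : nat -> T -> R)
    (i : nat) (w : T) : R := \sum_(j < i) Ys j w.

Definition geometric_prob (R : realType) (p : R) (i : nat) : R :=
  if i is j.+1 then p * (1 - p) ^+ j else 0.

Definition eta (R : realType) (x : R) : R := (1 + x)^-1.

Definition fubini (d : measure_display) (T : measurableType d)
    (R : realType) (P : probability T R) (Ys : nat -> {RV P >-> R})
    (n : nat) (x : R) : R :=
  limn (series (fun i : nat =>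
    fine 'E_P[(fun w => partial_sum Ys i w ^+ n)%R]
      * geometric_prob (eta x) i.+1)).

(* Main.v *)
Require Import Defs.
From HB Require Import structures.
From mathcomp Require Import all_boot all_order all_algebra.
From mathcomp Require Import finmap ring lra.
From mathcomp Require Import all_classical all_reals all_analysis.
From mathcomp Require Import measurable_realfun simple_functions.
From mathcomp Require Import measurable_fun_approximation.

Set Implicit Arguments.
Unset Strict Implicit.
Unset Printing Implicit Defensive.

Import Order.TTheory GRing.Theory Num.Theory.
Import numFieldNormedType.Exports.
Import HBNNSimple.

Local Open Scope classical_set_scope.
Local Open Scope ring_scope.

(** Write a = E e^{tY}, b = E e^{-tY}, p = 1 / (1 + x) and q = x / (1 + x), so
    that the weight of S_i in the Fubini polynomials is p q^i.

    By independence E e^{t S_i} = a^i ([mgf_partial_sum]), and a geometric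
    series gives
      sum_i p q^i E e^{t S_i} = p / (1 - q a) = 1 / (1 - x (a - 1)),
    the ratio q a being less than 1 exactly when x (a - 1) < 1.  Expanding each
    exponential in powers of t, the theorem says that the sum over i and the
    sum over n may be exchanged in
      sum_i p q^i sum_n E[S_i^n] t^n / n!.

    The domination that allows this comes from
      e^{|y|} <= e^y + e^{-y},
    which bounds every finite sum over n, uniformly, by a^i + b^i
    ([moment_sum_bound]).  Since x (b - 1) < 1 as well, p q^i (a^i + b^i) is
    summable in i.  Hence dominated convergence under the expectation gives
    sum_n E[S_i^n] t^n / n! = a^i for each i ([moment_sum_cvg]), and dominated
    convergence for series ([tannery]) carries the limit in n through the
    sum over i ([fubini_expansion]).

    Independence is given on events only.  The product rule for expectations
    ([expectation_prod_independent]) is obtained by replacing indicators with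
    nonnegative functions one coordinate at a time ([weighted_expectation]).

    When x = 0 the value E e^{tY} may be infinite, and when t = 0 the moments
    are not controlled by the exponentials; in both cases only the term n = 0
    of the series survives, and it equals 1. *)

(** * Expectation of a product of independent factors *)

(** For g an indicator the conclusion is the hypothesis; it passes to simple
    functions by linearity and to nonnegative measurable functions by monotone
    convergence.  The weight U stands for all the other factors of a product,
    of expectation c. *)
Lemma weighted_expectation (R : realType) (d : measure_display)
    (T : measurableType d) (P : probability T R) (V : {RV P >-> R})
    (U : T -> R) (g : R -> R) (c : R) :
  measurable_fun setT U -> measurable_fun setT g ->
  (forall w, 0 <= U w) -> (forall y, 0 <= g y) ->
  (forall B, measurable B ->
    \int[P]_w (U w * \1_B (V w))%:E = c%:E * P (V @^-1` B))%E ->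
  (\int[P]_w (U w * g (V w))%:E = c%:E * \int[P]_w (g (V w))%:E)%E.
Proof.
move=> mU mg' U0 g0 UB.
have mg : measurable_fun [set: R] (EFin \o g) by exact/measurable_EFinP.
pose s := nnsfun_approx measurableT mg.
have m1 : measurable_fun [set: T] (cst 1 : T -> R) by [].
have msV (h : {nnsfun R >-> R}) : measurable_fun [set: T] (h \o V).
  exact: measurableT_comp.
have preim0 (h : {nnsfun R >-> R}) (r : R) : r < 0 -> h @^-1` [set r] = set0.
  by move=> r0; rewrite preimage_nnfun0.
have pull (f : T -> R) (h : {nnsfun R >-> R}) :
    measurable_fun setT f -> (forall w, 0 <= f w) ->
    (\int[P]_w (f w * h (V w))%:E = \sum_(r \in range h)
      (r%:E * \int[P]_w (f w * \1_(h @^-1` [set r]) (V w))%:E))%E.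
  move=> mf f0.
  have mterm r : measurable_fun [set: T]
      (fun w => (f w * \1_(h @^-1` [set r]) (V w))%:E : \bar R).
    apply/measurable_EFinP; apply: measurable_funM => //.
    exact: measurableT_comp.
  have ge0 r w : (0 <= r%:E * (f w * \1_(h @^-1` [set r]) (V w))%:E)%E.
    rewrite EFinM muleCA; apply: mule_ge0; first by rewrite lee_fin.
    exact: nnfun_muleindic_ge0.
  transitivity (\int[P]_w \sum_(r \in range h)
      (r%:E * (f w * \1_(h @^-1` [set r]) (V w))%:E))%E.
    apply: eq_integral => w _.
    rewrite EFinM {1}fimfunE -fsumEFin// ge0_mule_fsumr; last first.
      by move=> r; rewrite EFinM nnfun_muleindic_ge0.
    by apply: eq_fsbigr => r _; rewrite -!EFinM mulrCA.
  rewrite ge0_integral_fsum//; last by move=> r; exact: measurable_funeM.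
  apply: eq_fsbigr => r _.
  (* A negative r is not a value of h: both sides vanish. *)
  have [r0|r0] := leP 0 r.
    by rewrite ge0_integralZl// => w _; rewrite lee_fin mulr_ge0.
  rewrite preim0// !integral0_eq ?mule0// => w _;
    by rewrite indicE in_set0 mulr0 ?mule0.
(* Both sides are expanded on the values of h; the right-hand one is the case of
   the weight 1, so that the hypothesis on U matches them term by term. *)
have simple (h : {nnsfun R >-> R}) : (\int[P]_w (U w * h (V w))%:E =
    c%:E * \int[P]_w (h (V w))%:E)%E.
  under [in RHS]eq_integral do rewrite -[h _]mul1r.
  have indicV r : (\int[P]_w (1 * \1_(h @^-1` [set r]) (V w))%:E =
      P (V @^-1` (h @^-1` [set r])))%E.
    under eq_integral do rewrite mul1r.
    by rewrite integral_indic ?setIT//; exact: measurable_funPTI.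
  rewrite (pull U)// (pull (cst 1))// ge0_mule_fsumr; last first.
    move=> r; have [r0|r0] := leP 0 r.
      apply: mule_ge0 => //; apply: integral_ge0 => w _.
      by rewrite lee_fin mulr_ge0.
    rewrite preim0// integral0_eq ?mule0// => w _.
    by rewrite indicE in_set0 mulr0.
  by apply: eq_fsbigr => r _; rewrite UB// muleCA indicV.
have lim_int (f : T -> R) : measurable_fun setT f -> (forall w, 0 <= f w) ->
    (\int[P]_w (f w * s n (V w))%:E @[n --> \oo] -->
     \int[P]_w (f w * g (V w))%:E)%E.
  move=> mf f0.
  rewrite [X in _ --> X](_ : _ =
    \int[P]_w limn (fun n => (f w * s n (V w))%:E))%E; last first.
    apply: eq_integral => w _; apply/esym/cvg_lim => //.
    rewrite EFinM; under eq_fun do rewrite EFinM.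
    apply: cvgeZl => //.
    apply: (@cvg_nnsfun_approx _ _ _ _ measurableT _ mg) => //.
    by move=> y _; rewrite lee_fin.
  apply: cvg_monotone_convergence => //.
  - move=> n; apply/measurable_EFinP; apply: measurable_funM => //.
    exact: msV.
  - by move=> n w _; rewrite lee_fin mulr_ge0.
  - move=> w _ m n mn; rewrite lee_fin ler_wpM2l//.
    exact/lefP/nd_nnsfun_approx.
have := lim_int _ mU U0.
under eq_fun do rewrite simple.
have /(cvgeZl _)-/(_ c%:E isT) := lim_int (cst 1) m1 (fun=> ler01).
under eq_fun do under eq_integral do rewrite /cst/= mul1r.
under [in X in _ --> X -> _]eq_integral do rewrite /cst/= mul1r.
by move=> cg cU; exact: (cvg_unique _ cU cg).
Qed.

Lemma expectation_prod_indic (R : realType) (d : measure_display)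
    (T : measurableType d) (P : probability T R) (Ys : nat -> {RV P >-> R})
    (B : nat -> set R) (n : nat) :
  mutually_independent Ys -> (forall j, measurable (B j)) ->
  (\int[P]_w (\prod_(j < n) \1_(B j) (Ys j w))%:E =
   \prod_(j < n) P (Ys j @^-1` B j))%E.
Proof.
move=> iY mB.
pose J := [fset j in iota 0 n]%fset.
have memJ j : (j \in J) = (j < n)%N.
  by rewrite in_fset/= mem_iota add0n.
have JE : perm_eq J (index_iota 0 n).
  apply: uniq_perm; [exact: fset_uniq|exact: iota_uniq|].
  by move=> j; rewrite memJ mem_index_iota.
transitivity (P (\bigcap_(i in [set` J]) (Ys i @^-1` B i))); last first.
  by rewrite iY// (perm_big _ JE)/= big_mkord.
rewrite -[X in P X]setIT -integral_indic//; last first.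
  apply: fin_bigcap_measurable => // j _.
  exact: measurable_funPTI.
apply: eq_integral => w _; congr (_%:E).
rewrite indicE; have [wJ|wJ] := boolP (w \in _).
  rewrite big1// => j _; rewrite indicE mem_set//.
  by move: wJ; rewrite inE => /(_ j); apply; rewrite /= memJ.
have [j jn] : exists2 j, (j < n)%N & ~ B j (Ys j w).
  apply: contrapT => H; move: wJ; rewrite notin_setE; apply => j /=.
  by rewrite memJ => jn; apply: contrapT => NB; apply: H; exists j.
by move=> NB; rewrite (bigD1 (Ordinal jn))//= indicE memNset// mul0r.
Qed.

(** The induction on k allows the first k factors to be arbitrary, the others
    still being indicators.  Freeing the factor k is one application of
    [weighted_expectation], whose hypothesis is the induction hypothesis with
    that factor turned back into an indicator. *)
Lemma expectation_prod_independent (R : realType) (d : measure_display)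
    (T : measurableType d) (P : probability T R) (Ys : nat -> {RV P >-> R})
    (h : nat -> R -> R) (c : nat -> R) (n : nat) :
  mutually_independent Ys -> (forall j, measurable_fun setT (h j)) ->
  (forall j y, 0 <= h j y) ->
  (forall j, \int[P]_w (h j (Ys j w))%:E = (c j)%:E)%E ->
  (\int[P]_w (\prod_(j < n) h j (Ys j w))%:E = (\prod_(j < n) c j)%:E)%E.
Proof.
move=> iY mh h0 hc.
suff: forall k (h : nat -> R -> R) (c : nat -> R),
    (forall j, measurable_fun setT (h j)) ->
    (forall j y, 0 <= h j y) ->
    (forall j, \int[P]_w (h j (Ys j w))%:E = (c j)%:E)%E ->
    (forall j, (k <= j < n)%N -> exists2 B, measurable B & h j = \1_B) ->
    (\int[P]_w (\prod_(j < n) h j (Ys j w))%:E = (\prod_(j < n) c j)%:E)%E.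
  by move=> /(_ n); apply => // j /andP[/leq_ltn_trans nj /nj]; rewrite ltnn.
have intI (j : nat) (B : set R) : measurable B ->
    (\int[P]_w (\1_B (Ys j w))%:E = P (Ys j @^-1` B))%E.
  move=> mB; rewrite -[X in P X]setIT -integral_indic//.
  exact: measurable_funPTI.
elim=> [|k IH] {mh h0 hc}h {}c mh h0 hc hI.
  have /choice[B hB] (j : nat) :
      exists B, measurable B /\ ((j < n)%N -> h j = \1_B).
    have [jn|jn] := boolP (j < n)%N.
      by have [//|B mB hB] := hI j; exists B.
    by exists setT.
  have mB j : measurable (B j) by case: (hB j).
  have hBn (j : 'I_n) : h j = \1_(B j) by case: (hB j) => _; apply.
  under eq_integral do under eq_bigr do rewrite hBn.
  rewrite expectation_prod_indic// -prodEFin; apply: eq_bigr => j _.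
  by rewrite -hc hBn intI.
have [kn|nk] := ltnP k n; last first.
  apply: IH => // j /andP[kj jn].
  by have := leq_ltn_trans kj jn; rewrite ltnNge nk.
pose U w := \prod_(j < n | j != Ordinal kn) h j (Ys j w).
pose C := \prod_(j < n | j != Ordinal kn) c j.
have UB B : measurable B ->
    (\int[P]_w (U w * \1_B (Ys k w))%:E = C%:E * P (Ys k @^-1` B))%E.
  move=> mB.
  pose h' j := if j == k then \1_B else h j.
  pose c' j := if j == k then fine (P (Ys k @^-1` B)) else c j.
  (* The coordinate k is set to the indicator of B, which brings the family back
     within reach of IH. *)
  have updateE (X : Type) (v : X) (w : nat -> X)
      (e := fun j => if j == k then v else w j) :
      e k = v /\ forall j : 'I_n, j != Ordinal kn -> e j = w j.
    rewrite /e eqxx; split=> // j jk.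
    by rewrite -[k]/(val (Ordinal kn)) (inj_eq val_inj) (negPf jk).
  have [h'k h'N] := updateE _ \1_B h.
  have [c'k c'N] := updateE _ (fine (P (Ys k @^-1` B))) c.
  have Ph' w : U w * \1_B (Ys k w) = \prod_(j < n) h' j (Ys j w).
    rewrite [RHS](bigD1 (Ordinal kn))//= /h' h'k mulrC; congr (_ * _).
    by apply: eq_bigr => j jk; rewrite h'N.
  under eq_integral do rewrite Ph'.
  rewrite (IH h' c').
  - rewrite (bigD1 (Ordinal kn))//= /c' c'k mulrC EFinM; congr (_%:E * _)%E.
      by apply: eq_bigr => j jk; rewrite c'N.
    by rewrite fineK// fin_num_measure//; exact: measurable_funPTI.
  - by move=> j; rewrite /h'; case: ifP.
  - by move=> j y; rewrite /h'; case: ifP => // _; rewrite indicE.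
  - move=> j; rewrite /h' /c'; case: eqP => [->|//].
    by rewrite intI// fineK// fin_num_measure//; exact: measurable_funPTI.
  - move=> j /andP[kj jn]; rewrite /h'.
    case: eqP => [_|/eqP jk]; first by exists B.
    by apply: hI; rewrite jn ltn_neqAle eq_sym jk kj.
rewrite [in RHS](bigD1 (Ordinal kn))//= -/C mulrC EFinM -hc.
rewrite -(@weighted_expectation _ _ _ _ _ U)//.
- by apply: eq_integral => w _; rewrite (bigD1 (Ordinal kn))//= mulrC.
- rewrite /U; under eq_fun do rewrite -big_filter.
  by apply: measurable_prod => j _; exact: measurableT_comp.
- by move=> w; apply: prodr_ge0.
Qed.

(** * Dominated convergence for series *)

(** Cutting all the series at a rank M beyond which g has a small tail leaves
    finite sums, where the limit in N may be taken term by term. *)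
Lemma tannery (R : realType) (u : nat -> nat -> R) (v g : nat -> R) :
  (forall N i, `|u N i| <= g i) -> cvgn (series g) ->
  (forall i, u ^~ i @ \oo --> v i) ->
  (fun N => limn (series (u N))) @ \oo --> limn (series v).
Proof.
move=> ug cg uv.
have g0 i : 0 <= g i by exact: le_trans (ug 0%N i).
have vg i : `|v i| <= g i.
  rewrite -(cvg_lim (@Rhausdorff R) (uv i)) -lim_norm; last exact: cvgP (uv i).
  apply: limr_le; first by apply: is_cvg_norm; exact: cvgP (uv i).
  by apply: nearW => N; exact: ug.
have cvg_dom (w : nat -> R) : (forall i, `|w i| <= g i) -> cvgn (series w).
  by move=> wg; apply: normed_cvg; exact: series_le_cvg wg cg.
(* The partial sums of g - w increase to their limit, hence a one-sided bound;
   applying it to - w gives the other side. *)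
have tail1 (w : nat -> R) M : (forall i, `|w i| <= g i) ->
    limn (series w) - series w M <= limn (series g) - series g M.
  move=> wg; have cw := cvg_dom _ wg.
  have : series (g - w) M <= limn (series (g - w)).
    apply: nondecreasing_cvgn_le; last exact: is_cvg_seriesB.
    apply: nondecreasing_series => i _ _; rewrite subr_ge0.
    exact: le_trans (ler_norm _) (wg i).
  rewrite lim_seriesB// seriesD seriesN.
  by rewrite -[leLHS]/(series g M - series w M); lra.
have tail (w : nat -> R) M : (forall i, `|w i| <= g i) ->
    `|limn (series w) - series w M| <= limn (series g) - series g M.
  move=> wg; rewrite ler_norml tail1// andbT lerNl opprB.
  have /(tail1 (- w) M) : forall i, `|(- w) i| <= g i.
    by move=> i; rewrite normrN.
  rewrite lim_seriesN ?seriesN//=; last exact: cvg_dom.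
  by rewrite -[(- series w) M]/(- series w M) opprK addrC.
apply/cvgrPdist_le => e e0.
have e3 : 0 < e / 3 by rewrite divr_gt0.
have [M _ /(_ M (leqnn _)) HM] : \forall M \near \oo,
    limn (series g) - series g M <= e / 3.
  move/cvgrPdist_le : cg => /(_ _ e3); apply: filterS => M; apply: le_trans.
  exact: ler_norm.
have : series (u N) M @[N --> \oo] --> series v M.
  by rewrite /series/=; apply: cvg_big => // *; exact: add_continuous.
move=> /cvgrPdist_le/(_ _ e3); apply: filterS => N H.
rewrite (_ : _ - _ = (limn (series v) - series v M)
    + (series v M - series (u N) M)
    - (limn (series (u N)) - series (u N) M)); last by ring.
rewrite (le_trans (ler_normB _ _))//.
rewrite (le_trans (lerD (ler_normD _ _) (lexx _)))//.
have := tail _ M vg; have := tail _ M (ug N).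
lra.
Qed.

(** * Moments and exponential moments *)

(** The left-hand side is a partial sum of the series of e^{|y|}, and e^{|y|} is
    one of the two terms on the right. *)
Lemma sum_normr_exp_coeff_le (R : realType) (y : R) (N : nat) :
  \sum_(0 <= n < N) `|exp_coeff y n| <= expR y + expR (- y).
Proof.
apply: (@le_trans _ _ (expR `|y|)); last first.
  by case: (ler0P y) => _; rewrite ?lerDl ?lerDr expR_ge0.
rewrite (eq_bigr (exp_coeff `|y|)) => [|n _]; last first.
  by rewrite /exp_coeff/= normrM normrX [X in _ * X]ger0_norm.
apply: (@nondecreasing_cvgn_le _ (series (exp_coeff `|y|))).
  by apply: nondecreasing_series => n _ _; exact: exp_coeff_ge0.
exact: is_cvg_series_exp_coeff.
Qed.

Lemma normr_exp_partial_sum (R : realType) (y : R) (N : nat) :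
  `|series (exp_coeff y) N| <= expR y + expR (- y).
Proof.
apply: (le_trans _ (sum_normr_exp_coeff_le y N)).
exact: ler_norm_sum.
Qed.

Lemma normr_exp_coeff (R : realType) (y : R) (n : nat) :
  `|exp_coeff y n| <= expR y + expR (- y).
Proof.
apply: (le_trans _ (sum_normr_exp_coeff_le y n.+1)).
by rewrite big_nat_recr//= lerDr sumr_ge0.
Qed.

Section moments.
Context (R : realType) (d : measure_display) (T : measurableType d)
  (P : probability T R) (S : T -> R) (t A B : R).
Hypotheses (mS : measurable_fun setT S) (t0 : t != 0).
Hypothesis EA : (\int[P]_w (expR (t * S w))%:E = A%:E)%E.
Hypothesis EB : (\int[P]_w (expR (- t * S w))%:E = B%:E)%E.

Let m n := fine 'E_P[(fun w => S w ^+ n)%R].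
Let G w := expR (t * S w) + expR (- t * S w).

Let mexp s : measurable_fun [set: T] (fun w => expR (s * S w)).
Proof. by apply: measurableT_comp => //; exact: measurable_funM. Qed.

Let intG : (\int[P]_w (G w)%:E = (A + B)%:E)%E.
Proof.
rewrite EFinD -EA -EB -ge0_integralD//; exact/measurable_EFinP/mexp.
Qed.

Let G0 w : 0 <= G w. Proof. by rewrite addr_ge0 ?expR_ge0. Qed.

Let mG : measurable_fun [set: T] G.
Proof. by apply: measurable_funD; exact: mexp. Qed.

Let iG : P.-integrable setT (EFin \o G).
Proof.
apply/integrableP; split; first exact/measurable_EFinP.
under eq_integral do rewrite /= ger0_norm//.
by rewrite intG ltry.
Qed.

Let mcoeff n : measurable_fun [set: T] (fun w => exp_coeff (t * S w) n).
Proof.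
apply: measurable_funM => //; apply: measurable_funX.
exact: measurable_funM.
Qed.

(* As t is not 0, this also shows that all the moments of S are finite. *)
Let icoeff n : P.-integrable setT (fun w => (exp_coeff (t * S w) n)%:E).
Proof.
apply: le_integrable iG => //; first exact/measurable_EFinP.
move=> w _; rewrite lee_fin (ger0_norm (G0 w)) /G mulNr.
exact: normr_exp_coeff.
Qed.

Let coeffE n : (\int[P]_w (exp_coeff (t * S w) n)%:E =
  (m n * (t ^+ n / n`!%:R))%:E)%E.
Proof.
have tn0 : t ^+ n / n`!%:R != 0.
  by rewrite mulf_neq0 ?invr_eq0 ?pnatr_eq0 -?lt0n ?fact_gt0// expf_neq0.
have iS : P.-integrable setT (fun w => (S w ^+ n)%:E).
  rewrite (_ : (fun _ => _) =
    (fun w => (t ^+ n / n`!%:R)^-1%:E * (exp_coeff (t * S w) n)%:E)%E).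
    exact: integrableZl.
  apply/funext => w; rewrite -EFinM; congr EFin; rewrite /exp_coeff/= exprMn.
  by rewrite [RHS]mulrC [t ^+ n * S w ^+ n]mulrC -[_ * _ / n`!%:R]mulrA mulfK.
rewrite EFinM /m fineK; last first.
  by rewrite unlock; exact: integrable_fin_num.
rewrite unlock -integralZr//.
apply: eq_integral => w _.
by rewrite -EFinM /exp_coeff/= exprMn [t ^+ n * S w ^+ n]mulrC -mulrA.
Qed.

(** What makes each series in i converge, for a fixed order n. *)
Lemma moment_bound n : `|m n * (t ^+ n / n`!%:R)| <= A + B.
Proof.
rewrite -lee_fin -intG -[(`|_|)%:E]/(`|_%:E|)%E -coeffE.
apply: (le_trans (le_abse_integral _ _ _)) => //; first exact/measurable_EFinP.
apply: ge0_le_integral => //.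
- exact/measurableT_comp/measurable_EFinP.
- exact/measurable_EFinP.
- by move=> w _; rewrite lee_fin /G mulNr; exact: normr_exp_coeff.
Qed.

Let sumE N : (\int[P]_w (series (exp_coeff (t * S w)) N)%:E =
  (\sum_(0 <= n < N) m n * (t ^+ n / n`!%:R))%:E)%E.
Proof.
under eq_integral do rewrite /series/= -sumEFin.
rewrite integral_sum//= -sumEFin.
by apply: eq_bigr => n _; exact: coeffE.
Qed.

Let msum N : measurable_fun [set: T] (fun w => series (exp_coeff (t * S w)) N).
Proof. by apply: measurable_sum => n; exact: mcoeff. Qed.

(** The bound does not depend on N: it is the majorant for the exchange of the
    limit in N with the sum over i. *)
Lemma moment_sum_bound N :
  `|\sum_(0 <= n < N) m n * (t ^+ n / n`!%:R)| <= A + B.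
Proof.
rewrite -lee_fin -intG -[(`|_|)%:E]/(`|_%:E|)%E -sumE.
apply: (le_trans (le_abse_integral _ _ _)) => //; first exact/measurable_EFinP.
apply: ge0_le_integral => //.
- exact/measurableT_comp/measurable_EFinP.
- exact/measurable_EFinP.
- by move=> w _; rewrite lee_fin /G mulNr; exact: normr_exp_partial_sum.
Qed.

(** Dominated convergence, with majorant e^{tS} + e^{-tS}. *)
Lemma moment_sum_cvg :
  (fun N => \sum_(0 <= n < N) m n * (t ^+ n / n`!%:R)) @ \oo --> A.
Proof.
have : (\int[P]_w (series (exp_coeff (t * S w)) N)%:E @[N --> \oo] -->
    \int[P]_w (expR (t * S w))%:E)%E.
  apply: (dominated_cvg _ _ _ _ iG) => //.
  - by move=> N; exact/measurable_EFinP/msum.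
  - move=> w _; apply: cvg_EFin; first exact: nearW.
    exact: is_cvg_series_exp_coeff.
  - move=> N w _; rewrite lee_fin /G mulNr; exact: normr_exp_partial_sum.
under eq_fun do rewrite sumE.
by rewrite EA => /fine_cvg.
Qed.
End moments.

(** * Partial sums of independent copies *)

Section copies.
Context (R : realType) (d0 : measure_display) (T0 : measurableType d0)
  (P0 : probability T0 R) (d : measure_display) (T : measurableType d)
  (P : probability T R) (Y : {RV P0 >-> R}) (Ys : nat -> {RV P >-> R}).
Hypothesis hYs : iid_copies Y Ys.

(** Both expectations are integrals against the law of Y, which is all that the
    copies share with Y when they live on another space. *)
Lemma mgf_copy (t : R) (j : nat) :
  (\int[P]_w (expR (t * Ys j w))%:E = 'M_P0 Y t)%E.
Proof.
pose f (y : R) : \bar R := (expR (t * y))%:E.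
have mf : measurable_fun [set: R] f.
  by apply/measurable_EFinP; apply: measurableT_comp.
have f0 y : (0 <= f y)%E by rewrite lee_fin expR_ge0.
rewrite -(ge0_integral_distribution _ mf f0).
rewrite /mmt_gen_fun unlock/=.
under [RHS]eq_integral do rewrite mulrC.
rewrite -(ge0_integral_distribution _ mf f0).
by apply: eq_measure_integral => B mB _; case: hYs => _; apply.
Qed.

Lemma mgf_partial_sum (t a : R) (i : nat) : ('M_P0 Y t = a%:E)%E ->
  (\int[P]_w (expR (t * partial_sum Ys i w))%:E = (a ^+ i)%:E)%E.
Proof.
move=> Ma.
under eq_integral do rewrite mulr_sumr expR_sum.
rewrite (@expectation_prod_independent _ _ _ _ _
  (fun=> expR \o *%R t) (fun=> a)).
- by rewrite prodr_const card_ord.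
- by case: hYs.
- by move=> j; apply: measurableT_comp => //; exact: measurable_funM.
- by move=> j y; exact: expR_ge0.
- by move=> j; rewrite -Ma mgf_copy.
Qed.

End copies.

Lemma measurable_partial_sum (R : realType) (d : measure_display)
    (T : measurableType d) (P : probability T R) (Ys : nat -> {RV P >-> R}) i :
  measurable_fun [set: T] (partial_sum Ys i).
Proof. by apply: measurable_sum. Qed.

(** The moments of order 0 equal 1, so this is the total mass of the geometric
    distribution. *)
Lemma fubini_order0 (R : realType) (d : measure_display)
    (T : measurableType d) (P : probability T R) (Ys : nat -> {RV P >-> R})
    (x : R) : 0 <= x -> fubini Ys 0 x = 1.
Proof.
move=> x0; rewrite /fubini; apply/cvg_lim => //.
have x1 : 0 < 1 + x by rewrite ltr_pwDl.
rewrite [X in series X](_ : _ =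
  geometric (Defs.eta x) (1 - Defs.eta x)); last first.
  apply/funext => i; under eq_fun do rewrite expr0.
  by rewrite (expectation_cst P 1)/= mul1r.
have sum1 : Defs.eta x * (1 - (1 - Defs.eta x))^-1 = 1.
  by rewrite opprB addrC subrK divff// /Defs.eta invr_eq0 gt_eqF.
have : `|1 - Defs.eta x| < 1.
  rewrite ger0_norm ?subr_ge0 ?invf_le1// ?lerDl// ltrBlDr ltrDl.
  by rewrite invr_gt0.
by move=> /(@cvg_geometric_series _ (Defs.eta x)); rewrite sum1.
Qed.

(** When x = 0 all the weight is on the empty sum S_0, whose positive powers
    vanish. *)
Lemma fubini_at0 (R : realType) (d : measure_display)
    (T : measurableType d) (P : probability T R) (Ys : nat -> {RV P >-> R})
    (n : nat) : (0 < n)%N -> fubini Ys n 0 = 0.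
Proof.
move=> n0; rewrite /fubini; apply/cvg_lim => //.
rewrite [X in series X](_ : _ = fun=> 0).
  rewrite /series/=; under eq_fun do rewrite big1//.
  exact: cvg_cst.
apply/funext => -[|i].
  rewrite /partial_sum; under eq_fun do rewrite big_ord0 expr0n gtn_eqF//=.
  by rewrite (expectation_cst P 0) mul0r.
by rewrite /geometric_prob /Defs.eta addr0 invr1 subrr expr0n/= !mulr0.
Qed.

(** * Generating function of the Fubini polynomials *)

Section expansion.
Context (R : realType) (d0 : measure_display) (T0 : measurableType d0)
  (P0 : probability T0 R) (d : measure_display) (T : measurableType d)
  (P : probability T R) (Y : {RV P0 >-> R}) (Ys : nat -> {RV P >-> R}).
Context (x t a b : R).
Hypotheses (hYs : iid_copies Y Ys) (x0 : 0 < x) (t0 : t != 0).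
Hypotheses (Ma : ('M_P0 Y t = a%:E)%E) (Mb : ('M_P0 Y (- t) = b%:E)%E).
Hypotheses (xa : x * (a - 1) < 1) (xb : x * (b - 1) < 1).

(** The exchange of summations: [tannery] is applied with u N i the first N
    terms of sum_n E[S_i^n] t^n / n!, times the weight of S_i. *)
Lemma fubini_expansion :
  series (fun n : nat => fubini Ys n x * (t ^+ n / n`!%:R)) @ \oo -->
    1 / (1 - x * (a - 1)).
Proof.
have mgf_ge0 s c : ('M_P0 Y s = c%:E)%E -> 0 <= c.
  by rewrite -lee_fin => <-; apply: expectation_ge0 => w; exact: expR_ge0.
have a0 := mgf_ge0 _ _ Ma; have b0 := mgf_ge0 _ _ Mb.
have x1 : 0 < 1 + x by rewrite ltr_pwDl// ltW.
pose q := 1 - Defs.eta x.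
have qE : q = x / (1 + x).
  by rewrite /q /Defs.eta; field; rewrite gt_eqF.
have q0 : 0 <= q by rewrite qE divr_ge0 ?ltW.
have eta0 : 0 <= Defs.eta x by rewrite invr_ge0 ltW.
have ratio c : 0 <= c -> x * (c - 1) < 1 -> `|q * c| < 1.
  move=> c0 xc; rewrite ger0_norm ?mulr_ge0// qE mulrAC ltr_pdivrMr// mul1r.
  by rewrite mulrBr mulr1 in xc; lra.
have geoE c i : c ^+ i * geometric_prob (Defs.eta x) i.+1 =
    geometric (Defs.eta x) (q * c) i.
  by rewrite /= -/q exprMn; ring.
have geo_cvg c : 0 <= c -> x * (c - 1) < 1 ->
    series (fun i => c ^+ i * geometric_prob (Defs.eta x) i.+1) @ \oo -->
      Defs.eta x * (1 - q * c)^-1.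
  move=> c0 xc; under eq_fun do rewrite geoE.
  exact: cvg_geometric_series (ratio _ c0 xc).
pose m n i := fine 'E_P[(fun w => partial_sum Ys i w ^+ n)%R].
pose p i := geometric_prob (Defs.eta x) i.+1.
have p0 i : 0 <= p i by rewrite mulr_ge0// exprn_ge0.
pose g i := (a ^+ i + b ^+ i) * p i.
have g0 i : 0 <= g i by rewrite mulr_ge0// addr_ge0// exprn_ge0.
have cg : cvgn (series g).
  rewrite (_ : g = (fun i => a ^+ i * p i) + (fun i => b ^+ i * p i)).
    by apply: is_cvg_seriesD; apply: cvgP; exact: geo_cvg.
  by apply/funext => i; rewrite /g mulrDl.
have Ea i := mgf_partial_sum hYs i Ma.
have Eb i := mgf_partial_sum hYs i Mb.
have mS i := measurable_partial_sum Ys i.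
have cm n : cvgn (series (fun i => m n i * p i)).
  pose tn := t ^+ n / n`!%:R.
  have tn0 : tn != 0.
    by rewrite mulf_neq0 ?invr_eq0 ?pnatr_eq0 -?lt0n ?fact_gt0// expf_neq0.
  have -> : (fun i => m n i * p i) = tn^-1 *: (fun i => m n i * tn * p i).
    apply/funext => i; rewrite -[RHS]/(tn^-1 * (m n i * tn * p i)).
    by rewrite mulrAC [_ * tn]mulrC mulKf.
  apply: is_cvg_seriesZ; apply: normed_cvg.
  apply: series_le_cvg cg => // i /=; first exact: normr_ge0.
  rewrite [leLHS]normrM (ger0_norm (p0 i)) /g ler_wpM2r//.
  exact: (moment_bound (mS i) t0 (Ea i) (Eb i)).
pose u N i := (\sum_(0 <= n < N) m n i * (t ^+ n / n`!%:R)) * p i.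
have sumE N : series (fun n => fubini Ys n x * (t ^+ n / n`!%:R)) N =
    limn (series (u N)).
  apply/esym/cvg_lim => //.
  have -> : series (u N) = (fun M => \sum_(0 <= n < N)
      series (fun i => m n i * p i) M * (t ^+ n / n`!%:R)).
    apply/funext => M; rewrite /series/= /u.
    under eq_bigr do rewrite mulr_suml.
    rewrite exchange_big/=; apply: eq_bigr => n _.
    by rewrite mulr_suml; apply: eq_bigr => i _; rewrite mulrAC.
  rewrite /series/=; apply: cvg_big; first exact: add_continuous.
  by move=> n _; apply: cvgMl; exact: cm.
suff limu : (fun N => limn (series (u N))) @ \oo --> 1 / (1 - x * (a - 1)).
  apply: cvg_trans limu; apply: near_eq_cvg; apply: nearW => N.
  exact: (esym (sumE N)).
have <- : limn (series (fun i => a ^+ i * p i)) = 1 / (1 - x * (a - 1)).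
  apply/cvg_lim => //.
  have -> : 1 / (1 - x * (a - 1)) = Defs.eta x * (1 - q * a)^-1.
    have xa' : 0 < 1 + x - x * a by move: xa; rewrite mulrBr mulr1; lra.
    by rewrite qE /Defs.eta; field; rewrite !gt_eqF.
  exact: geo_cvg.
apply: tannery cg _ => [N i|i].
  rewrite /u normrM (ger0_norm (p0 i)) /g ler_wpM2r//.
  exact: (moment_sum_bound (mS i) t0 (Ea i) (Eb i)).
apply: cvgMl.
exact: (moment_sum_cvg (mS i) t0 (Ea i) (Eb i)).
Qed.
End expansion.

Unset Implicit Arguments.

Theorem proposition2p1 (R : realType)
    (d0 : measure_display) (T0 : measurableType d0) (P0 : probability T0 R)
    (d : measure_display) (T : measurableType d) (P : probability T R)
    (Y : {RV P0 >-> R}) (Ys : nat -> {RV P >-> R}) (x t : R)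
    (hY : in_class_G Y) (hYs : iid_copies Y Ys) (hx : 0 <= x)
    (ht : (`| x%:E * ('M_P0 Y t - 1) | <= 1)%E)
    (hden : (x%:E * ('M_P0 Y t - 1) != 1)%E)
    (hNt : (x%:E * ('M_P0 Y (- t) - 1) < 1)%E) :
  series (fun n : nat => fubini Ys n x * (t ^+ n / n`!%:R)) @ \oo -->
    1 / (1 - x * (fine ('M_P0 Y t) - 1)).
Proof.
have [xt0|] := boolP ((x == 0) || (t == 0)).
  have -> : 1 / (1 - x * (fine ('M_P0 Y t) - 1)) = 1.
    case/orP: xt0 => /eqP ->; first by rewrite mul0r subr0 divr1.
    rewrite (_ : 'M_P0 Y 0 = 1%:E)%E ?subrr ?mulr0 ?subr0 ?divr1//.
    rewrite /mmt_gen_fun -(expectation_cst P0 1); congr expectation.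
    by apply/funext => w /=; rewrite mulr0 expR0.
  (* The partial sums equal 1 from rank 1 on, but not at rank 0. *)
  rewrite -(cvg_shiftS (series _)) /=.
  under eq_fun do rewrite /series/= big_nat_recl//=.
  rewrite fubini_order0// expr0 mul1r divr1.
  rewrite [X in X @ _](_ : _ = fun=> 1); first exact: cvg_cst.
  apply/funext => N; rewrite big1 ?addr0// => n _.
  case/orP: xt0 => /eqP ->; first by rewrite fubini_at0 ?mul0r.
  by rewrite expr0n mul0r mulr0.
rewrite negb_or => /andP[x0 t0].
have {}x0 : 0 < x by rewrite lt_neqAle eq_sym x0.
have lt1 : (x%:E * ('M_P0 Y t - 1) < 1)%E.
  by rewrite lt_neqAle hden (le_trans _ ht)// lee_abs.
(* An infinite exponential moment would make x (E e^{sY} - 1) infinite. *)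
have mgf_fin s : (x%:E * ('M_P0 Y s - 1) < 1)%E ->
    exists2 c, 'M_P0 Y s = c%:E & x * (c - 1) < 1.
  have : (0 <= 'M_P0 Y s)%E by apply: expectation_ge0 => w; exact: expR_ge0.
  case: ('M_P0 Y s) => [c _ xc|_|//]; first by exists c.
  by rewrite addye// gt0_muley.
have [a Ma xa] := mgf_fin _ lt1.
have [b Mb xb] := mgf_fin _ hNt.
by rewrite Ma; exact: (fubini_expansion hYs x0 t0 Ma Mb xa xb).
Qed.
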